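(* Let $S$ be a $\mathbb C^{n\times n}$-valued rational function such that the kernel $$K_S(z,w)=\frac{I_n-S(z)S(w)^*}{1-z\overline w}$$ has a finite number of negative squares in $(-1,1)$, from which has been removed possibly a finite set of points $P$. Then the kernel $K_S(z,w)$ has the same number of negative squares in the open unit disk, from which has been removed possibly a finite set of points $P_1$.
   Context: A $\mathbb C^{n\times n}$-valued function $K(u,v)$ with $K(u,v)=K(v,u)^*$ for $u,v\in\Omega$ has $\kappa$ negative squares in $\Omega$ if for all $M\in\mathbb N$, $u_1,\dots,u_M\in\Omega$ and $\xi_1,\dots,\xi_M\in\mathbb C^n$, the $M\times M$ Hermitian matrix with $(k,j)$ entry $\xi_k^*K(u_k,u_j)\xi_j$ has at most $\kappa$ strictly negative eigenvalues, and exactly $\kappa$ for some choice of $M,u_1,\dots,u_M,\xi_1,\dots,\xi_M$. The removed finite sets $P\subset(-1,1)$ and $P_1\subset\{z\in\mathbb C:|z|<1\}$ include the poles of $S$ in the respective sets, so that the kernel is defined on the remaining points. *)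

(* Defs.v *)
From HB Require Import structures.
From mathcomp Require Import all_boot all_order all_algebra.
From mathcomp Require Export complex.
From mathcomp Require Import boolp classical_sets cardinality set_interval reals.

Set Implicit Arguments.
Unset Strict Implicit.
Unset Printing Implicit Defensive.

Import Order.TTheory GRing.Theory Num.Theory.
Local Open Scope classical_set_scope.
Local Open Scope ring_scope.
Local Open Scope complex_scope.
Local Open Scope sesquilinear_scope.

Section RationalFunctions.
Variable F : fieldType.
Implicit Types (f : {fraction {poly F}}) (z : F).

(* Numerator and denominator in lowest terms: the representative of [f] chosen
   by the quotient need not be reduced. *)
Definition ratf_num f : {poly F} :=
  let r := repr f in \n_r %/ gcdp \n_r \d_r.
Definition ratf_den f : {poly F} :=
  let r := repr f in \d_r %/ gcdp \n_r \d_r.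

Definition ratf_pole f z : bool := root (ratf_den f) z.

(* Meaningful away from the poles; removable singularities are filled in. *)
Definition ratf_eval f z : F := (ratf_num f).[z] / (ratf_den f).[z].

Lemma ratf_coprime f : coprimep (ratf_num f) (ratf_den f).
Proof.
rewrite /ratf_num /ratf_den coprimep_div_gcd //.
by rewrite denom_ratioP orbT.
Qed.

Lemma ratf_den_neq0 f : ratf_den f != 0.
Proof.
rewrite /ratf_den dvdp_div_eq0 ?dvdp_gcdr //; exact: denom_ratioP.
Qed.

Lemma ratf_numdenE f :
  f = FracField.tofrac (ratf_num f) / FracField.tofrac (ratf_den f).
Proof.
rewrite /ratf_num /ratf_den; set r := repr f; set g := gcdp _ _.
have d0 : \d_r != 0 by exact: denom_ratioP.
have g0 : g != 0 by rewrite gcdp_eq0 negb_and d0 orbT.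
have en : \n_r = (\n_r %/ g) * g by rewrite divpK // dvdp_gcdl.
have ed : \d_r = (\d_r %/ g) * g by rewrite divpK // dvdp_gcdr.
have tF (p : {poly F}) : p != 0 -> FracField.tofrac p != 0.
  by rewrite tofrac_eq0.
have dg0 : \d_r %/ g != 0 by apply: contraNneq d0 => h; rewrite ed h mul0r.
apply: (mulIf (tF _ dg0)); rewrite mulfVK ?tF //.
apply: (mulIf (tF _ g0)); rewrite -mulrA -!tofracM -ed -en.
rewrite -[f]reprK -/r; unlock FracField.tofrac.
rewrite -[LHS]FracField.pi_mul; apply/eqP; rewrite eqmodE /= FracField.equivfE.
rewrite /FracField.mulf !numden_Ratio ?oner_neq0 ?mulf_neq0 ?oner_neq0 //.
by rewrite !mulr1 mulrC.
Qed.

Lemma ratf_poleE f z :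
  ~~ ratf_pole f z <->
  exists p q : {poly F},
    q.[z] != 0 /\ f = FracField.tofrac p / FracField.tofrac q.
Proof.
split=> [nz|[p [q [qz fE]]]].
  by exists (ratf_num f), (ratf_den f); split=> //; exact: ratf_numdenE.
have q0 : q != 0 by apply: contraNneq qz => ->; rewrite horner0.
have d0 := ratf_den_neq0 f.
have e : ratf_num f * q = p * ratf_den f.
  apply/eqP; rewrite -tofrac_eq !tofracM; apply/eqP.
  have := ratf_numdenE f; rewrite {1}fE => /eqP.
  by rewrite eqr_div ?tofrac_eq0 // => /eqP <-.
have dq : ratf_den f %| q.
  rewrite -(@Gauss_dvdpr _ _ (ratf_num f)); first by rewrite e dvdp_mull.
  by rewrite coprimep_sym ratf_coprime.
by apply: contra qz => rz; apply: (root_dvdp dq) rz.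
Qed.

Lemma ratf_evalE f z (p q : {poly F}) :
  q.[z] != 0 -> f = FracField.tofrac p / FracField.tofrac q ->
  ratf_eval f z = p.[z] / q.[z].
Proof.
move=> qz fE; have nz : ~~ ratf_pole f z by apply/ratf_poleE; exists p, q.
have q0 : q != 0 by apply: contraNneq qz => ->; rewrite horner0.
have d0 := ratf_den_neq0 f.
have e : ratf_num f * q = p * ratf_den f.
  apply/eqP; rewrite -tofrac_eq !tofracM; apply/eqP.
  have := ratf_numdenE f; rewrite {1}fE => /eqP.
  by rewrite eqr_div ?tofrac_eq0 // => /eqP <-.
by apply/eqP; rewrite eqr_div // -!hornerM e.
Qed.

Definition ratmx_eval n (S : 'M[{fraction {poly F}}]_n) z : 'M[F]_n :=
  \matrix_(i, j) ratf_eval (S i j) z.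

Definition ratmx_poles n (S : 'M[{fraction {poly F}}]_n) : set F :=
  [set z | exists i j, ratf_pole (S i j) z].

End RationalFunctions.

Section NegativeSquares.
Variable R : realType.
Local Notation C := R[i].

(* Eigenvalues are counted with algebraic multiplicity, as roots of the
   characteristic polynomial; [x < 0] in [R[i]] entails that [x] is real. *)
Definition neg_eigenvalues M (A : 'M[C]_M) : nat :=
  count (fun x : C => x < 0) (sval (closed_field_poly_normal (char_poly A))).

Definition kernel_mx n (K : C -> C -> 'M[C]_n) M
    (u : 'I_M -> C) (xi : 'I_M -> 'cV[C]_n) : 'M[C]_M :=
  \matrix_(k, j) (((xi k) ^t* *m K (u k) (u j) *m xi j) ord0 ord0).

Definition negative_squares n (K : C -> C -> 'M[C]_n) (Omega : set C)
    (kappa : nat) : Prop :=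
  [/\ forall u v, Omega u -> Omega v -> K u v = (K v u) ^t*,
      forall M (u : 'I_M -> C) (xi : 'I_M -> 'cV[C]_n),
        (forall k, Omega (u k)) ->
        (neg_eigenvalues (kernel_mx K u xi) <= kappa)%N &
      exists M (u : 'I_M -> C) (xi : 'I_M -> 'cV[C]_n),
        (forall k, Omega (u k)) /\
        neg_eigenvalues (kernel_mx K u xi) = kappa].

Definition schur_kernel n (S : 'M[{fraction {poly C}}]_n) (z w : C) : 'M[C]_n :=
  (1 - z * Num.conj w)^-1 *:
    (1%:M - ratmx_eval S z *m (ratmx_eval S w) ^t*).

Definition unit_disk : set C := [set z | `|z| < 1].

Definition real_unit_interval : set C := [set x%:C | x in `]-1, 1[ ].

End NegativeSquares.

Arguments unit_disk : clear implicits.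
Arguments real_unit_interval : clear implicits.

(* Main.v *)
Require Import Defs.
From mathcomp Require Import all_boot all_order all_algebra.
From mathcomp Require Import boolp classical_sets cardinality set_interval.
From mathcomp Require Import reals filter topology normedtype sequences.
From mathcomp Require Import ring.

(** The number of negative eigenvalues of a Hermitian matrix [A] is the largest
    [m] for which some [B *m A *m B ^t*] of size [m] is negative definite.  Such a
    property survives small perturbations of the entries of [A], so it is enough
    to approximate each kernel matrix over the disk by matrices that are
    congruent to pieces of kernel matrices over [(-1, 1) \ P].
    Clearing denominators, [q(z) q(w)^* K_S(z, w)] is a finite combination of
    kernels [p(z) r(w)^* / (1 - z w^* )] with [p], [r] polynomials.  Fix distinct
    nodes [t_l] in [(0, 1/2) \ P].  Projecting the Szego kernel at [u] onto the span
    of those at [t_0 .. t_(N-1)] gives coefficients [a_l(u)] for which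
      [1/(1 - u w^* ) - \sum_l a_l(u)/(1 - t_l w^* ) = B(u) B(w)^* / (1 - u w^* )],
    with [B] the Blaschke product of the nodes, and [B(u) -> 0] as [N] grows.
    On the kernels above, evaluation at [u] is therefore the limit of the
    combinations, with weights [a_l(u)], of evaluations at the nodes; this is
    seen by induction on the degrees of [p] and [r].  If [kappa] were not
    attained in the disk, the same bound with [P] enlarged by [P1] would show that
    it is not attained in [(-1, 1) \ P] either. *)

Set Implicit Arguments.
Unset Strict Implicit.
Unset Printing Implicit Defensive.

Import Order.TTheory GRing.Theory Num.Theory.
Import numFieldNormedType.Exports.
Local Open Scope classical_set_scope.
Local Open Scope ring_scope.
Local Open Scope sesquilinear_scope.

(** * Similarity invariance and conjugate transposes *)

Lemma char_poly_conj (F : fieldType) n (P A : 'M[F]_n) :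
  P \in unitmx -> char_poly (invmx P *m A *m P) = char_poly A.
Proof.
move=> Pu; set Q := invmx P.
have QP : Q *m P = 1%:M by exact: mulVmx.
have -> : char_poly (Q *m A *m P) =
  \det (map_mx polyC Q *m char_poly_mx A *m map_mx polyC P).
  rewrite /char_poly /char_poly_mx; congr (\det _).
  rewrite mulmxBr mulmxBl -!map_mxM scalar_mxC -(mulmxA 'X%:M) -map_mxM QP.
  by rewrite map_mx1 mulmx1.
by rewrite !det_mulmx mulrAC -det_mulmx -map_mxM QP map_mx1 det1 mul1r.
Qed.

Section Adjoint.
Variable C : numClosedFieldType.

Lemma adjmxK m n (A : 'M[C]_(m, n)) : (A ^t*) ^t* = A.
Proof. by rewrite map_trmx trmxK -map_mx_comp (map_mx_id (@conjCK _)). Qed.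

Lemma adjmxM m n p (A : 'M[C]_(m, n)) (B : 'M[C]_(n, p)) :
  (A *m B) ^t* = B ^t* *m A ^t*.
Proof. by rewrite trmx_mul map_mxM. Qed.

Lemma adjmxZ m n x (A : 'M[C]_(m, n)) : (x *: A) ^t* = x^* *: A ^t*.
Proof. by apply/matrixP => i j; rewrite !mxE rmorphM. Qed.

Lemma adjmxB m n (A B : 'M[C]_(m, n)) : (A - B) ^t* = A ^t* - B ^t*.
Proof. by apply/matrixP => i j; rewrite !mxE rmorphB. Qed.

Lemma adjmx1 n : (1%:M : 'M[C]_n) ^t* = 1%:M.
Proof. by rewrite trmx1 map_mx1. Qed.

Lemma hermsymmxE n (A : 'M[C]_n) : (A \is hermsymmx) = (A == A ^t*).
Proof. by rewrite is_hermitianmxE expr0 scale1r. Qed.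

End Adjoint.

(** * Negative definite forms *)

Section NegativeDefinite.
Variable C : numClosedFieldType.

Definition negdef m (X : 'M[C]_m) :=
  forall v : 'rV[C]_m, v != 0 -> (v *m X *m v ^t*) 0 0 < 0.

(** Put [E = X + 1] and [s = \sum_k |v_k|^2]. Bounding [|v_k| |v_l|] by the mean of the squares
    gives [|v E v^*| <= m s / (2 (m + 1)) < s]. The [m.+1] keeps the tolerance positive when
    [m = 0]. *)
Lemma negdef_near m (X : 'M[C]_m) : X \is hermsymmx ->
  (forall k l, `|X k l + (k == l)%:R| <= (2 * m.+1%:R)^-1) -> negdef X.
Proof.
move=> /is_hermitianmxP; rewrite expr0 scale1r => Xh Xe v v0.
pose E := X + 1%:M; pose s := \sum_k `|v 0 k| ^+ 2.
have s_gt0 : 0 < s.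
  rewrite lt_def sumr_ge0 ?andbT => [|k _]; last exact: exprn_ge0.
  apply: contra v0 => /eqP /psumr_eq0P s0.
  apply/eqP/rowP => k; rewrite mxE; apply/eqP.
  by rewrite -normr_eq0 -sqrf_eq0 s0 // => i _; exact: exprn_ge0.
have vv : (v *m v ^t*) 0 0 = s.
  by rewrite mxE; apply: eq_bigr => k _; rewrite !mxE normCK.
have -> : (v *m X *m v ^t*) 0 0 = (v *m E *m v ^t*) 0 0 - s.
  by rewrite -vv /E mulmxDr mulmxDl mulmx1 [in RHS]mxE addrK.
have Er : (v *m E *m v ^t*) 0 0 \is Num.real.
  rewrite CrealE; apply/eqP.
  have Eh : E ^t* = E by rewrite /E linearD map_mxD /= -Xh tr_scalar_mx map_mx1.
  have {2}-> : v *m E *m v ^t* = (v *m E *m v ^t*) ^t*.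
    by rewrite !trmx_mul !map_mxM /= Eh map_trmx trmxK -map_mx_comp
      (map_mx_id (@conjCK _)) mulmxA.
  by rewrite !mxE.
set e := (v *m E *m _) 0 0 in Er *.
rewrite subr_lt0; apply: le_lt_trans (real_ler_norm Er) _.
have le_e : `|e| <= (2 * m.+1%:R)^-1 * (m%:R * s).
  rewrite /e mxE; under eq_bigr do rewrite mxE mulr_suml.
  apply: (@le_trans _ _ (\sum_l \sum_k
      (2 * m.+1%:R)^-1 * ((`|v 0 k| ^+ 2 + `|v 0 l| ^+ 2) / 2))).
    apply: le_trans (ler_norm_sum _ _ _) _; apply: ler_sum => l _.
    apply: le_trans (ler_norm_sum _ _ _) _; apply: ler_sum => k _.
    rewrite !normrM mulrAC mulrC; apply: ler_pM => //.
    - by rewrite mulr_ge0.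
    - by rewrite !mxE.
    rewrite !mxE norm_conjC ler_pdivlMr // -subr_ge0.
    have -> : `|v 0 k| ^+ 2 + `|v 0 l| ^+ 2 - `|v 0 k| * `|v 0 l| * 2 =
      (`|v 0 k| - `|v 0 l|) ^+ 2 by ring.
    by rewrite real_exprn_even_ge0 // realB ?normr_real.
  under eq_bigr do rewrite -mulr_sumr -mulr_suml big_split /= sumr_const card_ord.
  rewrite -mulr_sumr -mulr_suml big_split /= sumr_const card_ord -/s -sumrMnl.
  by rewrite sumrMnl -/s -mulr2n -[s *+ m *+ 2]mulr_natr mulfK ?pnatr_eq0 //
    (mulr_natl s).
apply: le_lt_trans le_e _.
rewrite mulrC ltr_pdivrMr ?mulr_gt0 ?ltr0n // mulrC ltr_pM2l //.
by rewrite -natrM ltr_nat mul2n -addnn ltn_addr.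
Qed.

End NegativeDefinite.

(** * Negative eigenvalues of Hermitian matrices *)

Section SpectralCount.
Variable R : realType.
Local Notation C := R[i].

(** Unitary diagonalization splits the characteristic polynomial over the spectral diagonal, and two
    lists of roots of one polynomial are permutations of each other. *)
Lemma neg_eigenvaluesE M (A : 'M[C]_M) : A \is hermsymmx ->
  neg_eigenvalues A = #|[set j | spectral_diag A 0 j < 0]|%SET.
Proof.
move=> /hermitian_normalmx /orthomx_spectralP A_eq.
rewrite /neg_eigenvalues; case: closed_field_poly_normal => r /= rE.
have {}rE : \prod_(x <- r) ('X - x%:P) =
    \prod_(x <- [seq spectral_diag A 0 j | j : 'I_M]) ('X - x%:P).
  rewrite -[LHS]scale1r -{1}(monicP (char_poly_monic A)) -rE.
  rewrite {1}A_eq char_poly_conj ?spectral_unit //.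
  rewrite char_poly_trig ?diag_mx_is_trig // big_image /=.
  by apply: eq_bigr => j _; rewrite mxE eqxx mulr1n.
have /permP -> := prod_XsubC_eq rE.
rewrite count_map cardE -size_filter; congr size.
by rewrite enumT; apply: eq_filter => j; rewrite /= inE.
Qed.

(** The rows of [B] are unit eigenvectors for [m] negative eigenvalues [d], each scaled by
    [1 / sqrt (- d)]. *)
Lemma neg_eigenvalues_witness M (A : 'M[C]_M) m : A \is hermsymmx ->
  (m <= neg_eigenvalues A)%N ->
  exists B : 'M[C]_(m, M), B *m A *m B ^t* = - 1%:M.
Proof.
move=> Ah; rewrite neg_eigenvaluesE //; set J := (X in #|X|) => leJ.
have A_eq := orthomx_spectralP (hermitian_normalmx Ah).
set P := spectralmx A in A_eq; set D := spectral_diag A in J leJ A_eq.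
have PP : P *m P ^t* = 1%:M by apply/unitarymxP/spectral_unitarymx.
have IP : invmx P = P ^t* by apply/invmx_unitary/spectral_unitarymx.
pose f (k : 'I_m) : 'I_M := enum_val (widen_ord leJ k).
have fI : injective f by move=> k l /enum_val_inj /(congr1 val) /= /val_inj.
have Df k : D 0 (f k) < 0 by have := enum_valP (widen_ord leJ k); rewrite inE.
pose c k := (sqrtC (- D 0 (f k)))^-1.
have cE k : c k * D 0 (f k) * (c k)^* = -1.
  have Dk : 0 < - D 0 (f k) by rewrite oppr_gt0.
  rewrite -[X in _ * X * _]opprK mulrN mulNr mulrAC -normCK; congr (- _).
  rewrite /c normfV ger0_norm ?sqrtC_ge0 ?ltW // exprVn sqrtCK mulVf //.
  by rewrite gt_eqF.
pose E : 'M[C]_(m, M) := \matrix_(k, j) (c k *+ (j == f k)).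
exists (E *m P); rewrite trmx_mul map_mxM A_eq IP -!mulmxA (mulmxA P) PP mul1mx.
rewrite (mulmxA P) PP mul1mx; apply/matrixP => k l; rewrite !mxE.
rewrite (bigD1 (f k)) //= big1 ?addr0 => [|j jk]; last first.
  by rewrite mxE (negbTE jk) mul0r.
rewrite mul_diag_mx !mxE eqxx mulr1n (inj_eq fI).
have [->|kl] := eqVneq k l; first by rewrite mulr1n mulrA cE.
by rewrite mulr0n rmorph0 !mulr0 oppr0.
Qed.

(** Dimension count: with fewer than [m] negative eigenvalues, some nonzero combination of the rows
    of [B] has no component along their eigenvectors, and the form is nonnegative there. *)
Lemma negdef_le_neg_eigenvalues M (A : 'M[C]_M) m (B : 'M[C]_(m, M)) :
  A \is hermsymmx -> negdef (B *m A *m B ^t*) -> (m <= neg_eigenvalues A)%N.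
Proof.
move=> Ah Bneg; rewrite neg_eigenvaluesE //; set J := (X in #|X|).
rewrite leqNgt; apply/negP => ltJ.
have A_eq := orthomx_spectralP (hermitian_normalmx Ah).
set P := spectralmx A in A_eq; set D := spectral_diag A in J ltJ A_eq.
have IP : invmx P = P ^t* by apply/invmx_unitary/spectral_unitarymx.
pose W := B *m P ^t*.
pose WJ : 'M[C]_(m, #|J|) := colsub enum_val W.
have /rowV0Pn[v] : kermx WJ != 0.
  rewrite -mxrank_eq0 mxrank_ker subn_eq0 -ltnNge.
  exact: leq_ltn_trans (rank_leq_col _) ltJ.
move=> /sub_kermxP vW /Bneg.
have -> : v *m (B *m A *m B ^t*) *m v ^t* =
    (v *m W) *m diag_mx D *m (v *m W) ^t*.
  rewrite !trmx_mul !map_mxM A_eq IP !mulmxA.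
  by rewrite map_trmx trmxK -map_mx_comp (map_mx_id (@conjCK _)).
set y := v *m W.
suff : 0 <= (y *m diag_mx D *m y ^t*) 0 0 by move=> /le_gtF ->.
rewrite mxE; apply: sumr_ge0 => j _; rewrite mul_mx_diag !mxE.
rewrite mulrAC; have [jJ|] := boolP (j \in J); last first.
  have /mxOverP/(_ 0 j) Dr := hermitian_spectral_diag_real Ah.
  rewrite inE => jJ; apply: mulr_ge0; first exact: mul_conjC_ge0.
  by rewrite real_leNgt ?real0.
have /matrixP/(_ 0 (enum_rank_in jJ j)) := vW.
rewrite mxE; under eq_bigr do rewrite mxE enum_rankK_in //.
by move=> yj; rewrite yj !mxE !mul0r.
Qed.

End SpectralCount.

(** * Blaschke products and interpolation of the Szego kernel *)

Section Interpolation.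
Variable C : numClosedFieldType.
Implicit Types (t u v w x y : C) (p r : {poly C}).

Lemma subr1M_neq0 x y : `|x| < 1 -> `|y| < 1 -> 1 - x * y != 0.
Proof.
move=> x1 y1; rewrite subr_eq0; apply/eqP => /(congr1 Num.norm).
rewrite normr1 normrM => /eqP; rewrite gt_eqF //.
by rewrite -[ltRHS]mulr1 ltr_pM.
Qed.

Lemma szego_neq0 x y : `|x| < 1 -> `|y| < 1 -> 1 - x * y^* != 0.
Proof. by move=> x1 y1; rewrite subr1M_neq0 ?norm_conjC. Qed.

Definition blaschke t u := (u - t) / (1 - t^* * u).

(** In the Hardy space the left side is the reproducing kernel of the complement of the multiples of
    the Blaschke factor. That complement is spanned by the Szego kernel at [t], hence the rank one
    right side. *)
Lemma blaschke_szego t u w : `|t| < 1 -> `|u| < 1 -> `|w| < 1 ->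
  (1 - u * w^*)^-1 - blaschke t u * (blaschke t w)^* / (1 - u * w^*) =
  (1 - t * t^*) / ((1 - t^* * u) * (1 - t * w^*)).
Proof.
move=> t1 u1 w1; rewrite /blaschke rmorphM /= fmorphV !rmorphB rmorphM rmorph1 /=.
rewrite conjCK; have := szego_neq0 u1 w1; have := szego_neq0 t1 w1.
have : 1 - t^* * u != 0 by rewrite subr1M_neq0 ?norm_conjC.
move=> h1 h2 h3; field; rewrite h1 h2 h3 //.
Qed.

Lemma blaschke_eq0 t u : `|t| < 1 -> `|u| < 1 -> (blaschke t u == 0) = (u == t).
Proof.
move=> t1 u1; rewrite mulf_eq0 invr_eq0 subr_eq0 orbC.
by rewrite (negbTE (subr1M_neq0 _ u1)) ?norm_conjC.
Qed.

Lemma one_sub_normsq u : `|u| < 1 -> 0 < 1 - u * u^*.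
Proof. by move=> u1; rewrite -normCK subr_gt0 expr_lt1. Qed.

(** Case [w = u] of [blaschke_szego]: here [1 - |t|^2 >= 3/4] and [|1 - t^* u| <= 2], and
    [3/16 >= 1/8]. The bound does not depend on [t], so products over nodes decay geometrically. *)
Lemma blaschke_norm_le t u : `|t| <= 2^-1 -> `|u| < 1 ->
  `|blaschke t u| ^+ 2 <= 1 - (1 - u * u^*) / 8.
Proof.
move=> t2 u1; have t1 : `|t| < 1.
  by apply: le_lt_trans t2 _; rewrite invf_lt1 ?ltr0n // ltr1n.
have s_gt0 := one_sub_normsq u1; set s := 1 - u * u^* in s_gt0 *.
have D_gt0 : 0 < (1 - t^* * u) * (1 - t * u^*).
  have -> : 1 - t * u^* = (1 - t^* * u)^*.
    by rewrite rmorphB rmorphM rmorph1 /= conjCK.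
  by rewrite -normCK exprn_gt0 // normr_gt0 subr1M_neq0 ?norm_conjC.
have := blaschke_szego t1 u1 u1; rewrite -/s -normCK.
set c := _ / (_ * _) => cE.
have -> : `|blaschke t u| ^+ 2 = 1 - s * c.
  by rewrite -cE; field; rewrite gt_eqF.
rewrite lerD2l lerN2 ler_pM2l // /c ler_pdivlMr // mulrC ler_pdivrMr ?ltr0n //.
apply: (@le_trans _ _ (2 * 2)).
  have le2 x : `|x| < 1 -> `|1 - t * x| <= 2.
    move=> x1; apply: le_trans (ler_normB _ _) _; rewrite normr1 normrM.
    by rewrite -[2]/(1 + 1) lerD2l mulr_ile1 // ltW.
  rewrite -[leLHS](ger0_norm (ltW D_gt0)) normrM.
  apply: ler_pM => //; last by rewrite le2 ?norm_conjC.
  by rewrite -norm_conjC rmorphB rmorphM rmorph1 /= conjCK le2 ?norm_conjC.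
have : `|t| ^+ 2 <= 2^-1 ^+ 2 by rewrite ler_pXn2r ?nnegrE ?invr_ge0 ?ler0n.
rewrite normCK => t4.
apply: (@le_trans _ _ ((1 - 2^-1 ^+ 2) * 8));
  last by rewrite ler_pM2r ?ltr0n ?lerD2l ?lerN2.
have -> : (1 - 2^-1 ^+ 2) * 8 = 6 :> C by field.
by rewrite -natrM ler_nat.
Qed.

Variable t : nat -> C.
Hypothesis t_lt1 : forall l, `|t l| < 1.
Hypothesis t_inj : injective t.

Definition blaschke_prod N u := \prod_(l < N) blaschke (t l) u.

Lemma blaschke_prod_eq0 N l : (l < N)%N -> blaschke_prod N (t l) = 0.
Proof.
move=> lN; apply/eqP/prodf_eq0; exists (Ordinal lN) => //=.
by rewrite blaschke_eq0.
Qed.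

Lemma blaschke_prod_neq0 N : blaschke_prod N (t N) != 0.
Proof.
apply/prodf_neq0 => l _; rewrite blaschke_eq0 // (inj_eq t_inj).
by rewrite gtn_eqF.
Qed.

Lemma szego_interpolation N : exists a : C -> nat -> C,
  forall u w, `|u| < 1 -> `|w| < 1 ->
  (1 - u * w^*)^-1 - \sum_(l < N) a u l / (1 - t l * w^*) =
  blaschke_prod N u * (blaschke_prod N w)^* / (1 - u * w^*).
Proof.
elim: N => [|N [a aE]].
  exists (fun=> fun=> 0) => u w _ _.
  by rewrite /blaschke_prod !big_ord0 subr0 rmorph1 !mul1r.
(* Subtracting [c u] times the residual at [t N] from the residual at [u] leaves, by
   [blaschke_szego], exactly one more Blaschke factor in each variable. Distinct nodes make the
   divisor nonzero. *)
pose c u := (1 - t N * (t N)^*) / (1 - (t N)^* * u) *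
  (blaschke_prod N u / blaschke_prod N (t N)).
exists (fun u l => if (l < N)%N then a u l - c u * a (t N) l else c u) => u w u1 w1.
rewrite big_ord_recr /= ltnn; under eq_bigr do rewrite ltn_ord mulrBl -mulrA.
rewrite sumrB -mulr_sumr.
have := aE _ _ u1 w1; have := aE _ _ (t_lt1 N) w1.
have := blaschke_szego (t_lt1 N) u1 w1; have := blaschke_prod_neq0 N.
have uw := szego_neq0 u1 w1; have tw := szego_neq0 (t_lt1 N) w1.
have tu : 1 - (t N)^* * u != 0 by rewrite subr1M_neq0 ?norm_conjC.
rewrite /blaschke_prod !big_ord_recr /= -!/(blaschke_prod N _).
set b1 := blaschke (t N) u; set b2 := (blaschke (t N) w)^*.
set B1 := blaschke_prod N (t N); set B2 := blaschke_prod N u.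
set B3 := (blaschke_prod N w)^*; set S2 := \sum_(i < N) _; set S1 := \sum_(i < N) _.
move=> B1_neq0 e1 e2 e3; rewrite (rmorphM _ _ (blaschke _ _)) -/B3 -/b2.
have -> : (1 - u * w^*)^-1 - (S1 - c u * S2 + c u / (1 - t N * w^*)) =
  B2 * B3 / (1 - u * w^*) - c u * (B1 * B3 / (1 - t N * w^*)).
  by rewrite -e2 -e3; ring.
have -> : B2 * b1 * (B3 * b2) / (1 - u * w^*) =
  B2 * B3 * (b1 * b2 / (1 - u * w^*)) by ring.
have -> : b1 * b2 / (1 - u * w^*) = (1 - u * w^*)^-1 -
    (1 - t N * (t N)^*) / ((1 - (t N)^* * u) * (1 - t N * w^*)).
  by rewrite -e1; ring.
rewrite /c -/B1 -/B2; field.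
by rewrite B1_neq0 uw tu tw.
Qed.

Lemma geometric_sumE x K : x != 1 ->
  \sum_(k < K) x ^+ k = (1 - x ^+ K) / (1 - x).
Proof.
move=> x1; apply: (mulIf (_ : 1 - x != 0)); first by rewrite subr_eq0 eq_sym.
by rewrite mulfVK ?subr_eq0 1?eq_sym // -opprB mulrC mulNr -subrX1 opprB.
Qed.

(** This can fail in a non-archimedean field, so it is assumed for abstract [C] and established for
    [R[i]] by [cvg_exprC]. *)
Hypothesis cvg_expr : forall x : C, `|x| < 1 -> x ^+ n @[n --> \oo] --> (0 : C).

(** The order on [C] is only partial; the limit is nonnegative because it equals its own norm, by
    uniqueness of limits. *)
Lemma cvg_ge0 (f : nat -> C) (l : C) :
  (\forall n \near \oo, 0 <= f n) -> f n @[n --> \oo] --> l -> 0 <= l.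
Proof.
move=> f0 fl; suff -> : l = `|l| by [].
apply: (cvg_unique _ fl) => //.
apply: cvg_trans (cvg_norm fl); apply: near_eq_cvg.
by apply: filterS f0 => n /ger0_norm.
Qed.

(* The Szego kernel is the sum of the rank one kernels [x ^+ k * (y ^+ k)^*]. *)
Lemma moment_le n (x e : 'I_n -> C) k : (forall i, `|x i| < 1) ->
  `|\sum_i e i * x i ^+ k| ^+ 2 <=
  \sum_i \sum_j e i * (e j)^* / (1 - x i * (x j)^*).
Proof.
move=> x1; set Q := (leRHS); pose m k := \sum_i e i * x i ^+ k.
(* [T K] is the tail of [Q] after [K] terms of the geometric series of each entry. *)
pose T K := \sum_i \sum_j
  e i * (e j)^* / (1 - x i * (x j)^*) * (x i * (x j)^*) ^+ K.
have sumE K : \sum_(k < K) `|m k| ^+ 2 = Q - T K.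
  under eq_bigr => l _ do rewrite normCK /m rmorph_sum mulr_suml.
  rewrite exchange_big /Q /T -sumrB; apply: eq_bigr => i _.
  under eq_bigr => l _ do rewrite mulr_sumr.
  rewrite exchange_big -sumrB; apply: eq_bigr => j _ /=.
  rewrite -[X in X - _]mulr1 -mulrBr mulrAC -[RHS]mulrA -geometric_sumE; last first.
    by rewrite eq_sym -subr_eq0 szego_neq0.
  rewrite mulr_sumr; apply: eq_bigr => l _.
  by rewrite rmorphM rmorphXn exprMn /=; ring.
have T0 : T K @[K --> \oo] --> (0 : C).
  rewrite [X in _ --> X](_ : 0 = \sum_(i < n) \sum_(j < n)
    e i * (e j)^* / (1 - x i * (x j)^*) * 0); last first.
    by under eq_bigr do under eq_bigr do rewrite mulr0; rewrite !big1.
  apply: cvg_big => [|i _]; first exact: add_continuous.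
  apply: cvg_big => [|j _]; first exact: add_continuous.
  apply: cvgMr; apply: cvg_expr.
  by rewrite normrM norm_conjC -[ltRHS]mulr1 ltr_pM.
rewrite -subr_ge0 -[Q]subr0.
apply: (@cvg_ge0 (fun K => Q - T K - `|m k| ^+ 2)).
  near=> K; have kK : (k < K)%N by near: K; exact: nbhs_infty_gt.
  rewrite -sumE (bigD1 (Ordinal kK)) //= addrC addrK.
  by apply: sumr_ge0 => l _; exact: exprn_ge0.
by apply: cvgB; [apply: cvgB => //|]; exact: cvg_cst.
Unshelve. all: by end_near.
Qed.

Lemma cvg0_le (f g : nat -> C) : (forall n, `|f n| <= `|g n|) ->
  g n @[n --> \oo] --> (0 : C) -> f n @[n --> \oo] --> (0 : C).
Proof.
move=> fg /cvgr0Pnorm_le g0; apply/cvgr0Pnorm_le => e /g0.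
by apply: filterS => n; exact: le_trans.
Qed.

Lemma cvg0_sqr (f g : nat -> C) : (forall n, `|f n| ^+ 2 <= `|g n|) ->
  g n @[n --> \oo] --> (0 : C) -> f n @[n --> \oo] --> (0 : C).
Proof.
move=> fg /cvgr0Pnorm_le g0; apply/cvgr0Pnorm_le => e e0.
have /g0 : 0 < e ^+ 2 by rewrite exprn_gt0.
apply: filterS => n /(le_trans (fg n)).
by rewrite ler_pXn2r ?nnegrE ?(ltW e0).
Qed.

Hypothesis t_le : forall l, `|t l| <= 2^-1.

Lemma cvg_blaschke_prod u : `|u| < 1 ->
  `|blaschke_prod N u| ^+ 2 @[N --> \oo] --> (0 : C).
Proof.
move=> u1; pose rho := 1 - (1 - u * u^*) / 8.
have s_gt0 := one_sub_normsq u1.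
have rho_ge0 : 0 <= rho.
  by apply: le_trans (blaschke_norm_le (t_le 0) u1); exact: exprn_ge0.
apply: (@cvg0_le _ (fun N => rho ^+ N)).
  move=> N; rewrite normrX normr_id normrX (ger0_norm rho_ge0).
  rewrite /blaschke_prod normr_prod -prodrXl -[X in rho ^+ X]card_ord -prodr_const.
  apply: ler_prod => l _; rewrite exprn_ge0 //=; exact: blaschke_norm_le.
apply: cvg_expr; rewrite ger0_norm // /rho gtrDl oppr_lt0.
by rewrite divr_gt0 ?ltr0n.
Qed.

(** Coefficients carry the index [N] because adding a node may change all the earlier ones. *)
Variable a : nat -> C -> nat -> C.
Hypothesis aE : forall N u w, `|u| < 1 -> `|w| < 1 ->
  (1 - u * w^*)^-1 - \sum_(l < N) a N u l / (1 - t l * w^*) =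
  blaschke_prod N u * (blaschke_prod N w)^* / (1 - u * w^*).

(** The residual vanishes when [w] is one of the nodes, since the Blaschke product does. *)
Lemma interpolation_exact N u l : `|u| < 1 -> (l < N)%N ->
  \sum_(l' < N) (a N u l')^* / (1 - t l * (t l')^*) = (1 - t l * u^*)^-1.
Proof.
move=> u1 lN; have := aE N u1 (t_lt1 l).
rewrite blaschke_prod_eq0 // rmorph0 mulr0 mul0r => /eqP.
rewrite subr_eq0 => /eqP /(congr1 (fun x => x^*)).
rewrite rmorph_sum fmorphV rmorphB rmorphM rmorph1 /= conjCK mulrC => ->.
by apply: eq_bigr => l' _;
  rewrite rmorphM fmorphV rmorphB rmorphM rmorph1 /= conjCK (mulrC (t l)).
Qed.

(** Apply [moment_le] to the nodes with weights [- a N u l] together with [u] with weight 1. In the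
    resulting quadratic form every term at a node vanishes, and only the residual at [(u, u)]
    remains. *)
Lemma moment_error N u k : `|u| < 1 ->
  `|u ^+ k - \sum_(l < N) a N u l * t l ^+ k| ^+ 2 <=
  `|blaschke_prod N u| ^+ 2 / (1 - u * u^*).
Proof.
move=> u1.
pose x (i : 'I_N.+1) := if (i < N)%N then t i else u.
pose e (i : 'I_N.+1) := if (i < N)%N then - a N u i else 1.
have x1 i : `|x i| < 1 by rewrite /x; case: ifP.
have eE (g : C -> C) : \sum_i e i * g (x i) = g u - \sum_(l < N) a N u l * g (t l).
  rewrite big_ord_recr /= /e /x /= ltnn mul1r addrC -sumrN; congr (_ + _).
  by apply: eq_bigr => l _; rewrite ltn_ord mulNr.
have := moment_le e k x1; rewrite (eE (fun y => y ^+ k)).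
move=> /le_trans; apply; rewrite exchange_big /=.
under eq_bigr => j _.
  under eq_bigr => i _ do rewrite mulrAC mulrC.
  rewrite -mulr_sumr (eE (fun y => (1 - y * (x j)^*)^-1)) aE //.
  over.
rewrite big_ord_recr /= big1 => [|l _]; last first.
  by rewrite /x /= ltn_ord blaschke_prod_eq0 // rmorph0 !(mulr0, mul0r).
by rewrite /e /x /= ltnn rmorph1 mul1r add0r normCK.
Qed.

Lemma cvg_moment u p : `|u| < 1 ->
  \sum_(l < N) a N u l * p.[t l] @[N --> \oo] --> p.[u].
Proof.
move=> u1; rewrite (_ : p.[u] = \sum_(k < size p) p`_k * u ^+ k) ?horner_coef //.
under eq_fun => N.
  under eq_bigr => l _ do rewrite horner_coef mulr_sumr.
  rewrite exchange_big /=.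
  under eq_bigr => k _ do under eq_bigr => l _ do rewrite mulrCA.
  under eq_bigr => k _ do rewrite -mulr_sumr.
  over.
apply: cvg_big => [|k _]; first exact: add_continuous.
apply: cvgMr; apply/subr_cvg0.
pose c := (1 - u * u^*)^-1.
apply: (@cvg0_sqr _ (fun N => c * `|blaschke_prod N u| ^+ 2)).
  move=> N; rewrite distrC; apply: le_trans (moment_error N k u1) _.
  rewrite mulrC; apply/real_ler_norm/ger0_real.
  by rewrite mulr_ge0 ?exprn_ge0 // invr_ge0 ltW // one_sub_normsq.
rewrite -[X in _ --> X](mulr0 c); apply: cvgMr.
exact: cvg_blaschke_prod.
Qed.

(** For [v] nonzero, [w / (1 - w v^* )] is a combination of [1 / (1 - w v^* )] and 1, so a factor
    ['X] reduces to the induction hypothesis and a moment; for [v = 0] only a moment is left. *)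
Lemma cvg_szego_combination u v p : `|u| < 1 -> `|v| < 1 ->
  \sum_(l < N) a N u l * p.[t l] / (1 - t l * v^*) @[N --> \oo] -->
  p.[u] / (1 - u * v^*).
Proof.
move=> u1 v1; elim/poly_ind: p => [|p c IHp].
  rewrite horner0 mul0r; under eq_fun => N.
    rewrite big1 => [|l _]; last by rewrite horner0 mulr0 mul0r.
    over.
  exact: cvg_cst.
have cvg1 : \sum_(l < N) a N u l / (1 - t l * v^*) @[N --> \oo] -->
    (1 - u * v^*)^-1.
  apply/subr_cvg0.
  pose b N := blaschke_prod N u * (blaschke_prod N v)^* / (1 - u * v^*).
  have b0 w : `|w| < 1 -> blaschke_prod N w @[N --> \oo] --> (0 : C).
    move=> w1; apply: cvg0_sqr (cvg_blaschke_prod w1) => N.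
    by rewrite normrX normr_id.
  apply: (@cvg0_le _ b) => [N|]; first by rewrite /b -aE // distrC.
  rewrite [X in _ --> X](_ : 0 = 0 * 0 / (1 - u * v^*)); last by rewrite !mul0r.
  apply: cvgMl; apply: cvgM; first exact: b0.
  apply: (@cvg0_le _ (fun N => blaschke_prod N v)); last exact: b0.
  by move=> N; rewrite norm_conjC.
have cvgX : \sum_(l < N) a N u l * ('X * p).[t l] / (1 - t l * v^*)
    @[N --> \oo] --> ('X * p).[u] / (1 - u * v^*).
  have [->|v0] := eqVneq v 0.
    rewrite rmorph0 mulr0 subr0 divr1; under eq_fun => N.
      under eq_bigr => l _ do rewrite mulr0 subr0 divr1.
      over.
    exact: cvg_moment.
  have vc0 : v^* != 0 by rewrite conjC_eq0.
  have shift w : 1 - w * v^* != 0 ->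
      w / (1 - w * v^*) = (v^*)^-1 * ((1 - w * v^*)^-1 - 1).
    by move=> w0; field; rewrite w0.
  rewrite hornerM hornerX mulrAC shift ?szego_neq0 //.
  under eq_fun => N.
    under eq_bigr => l _.
      rewrite hornerM hornerX mulrCA mulrAC shift ?szego_neq0 // -mulrA mulrBl mul1r.
      rewrite [_^-1 * (_ * _)]mulrC.
      over.
    rewrite -mulr_sumr sumrB.
    over.
  rewrite -mulrA mulrBl mul1r [_^-1 * _.[u]]mulrC.
  by apply: cvgMr; apply: cvgB => //; exact: cvg_moment.
rewrite [p * 'X]mulrC hornerD hornerC mulrDl; under eq_fun => N.
  under eq_bigr => l _.
    rewrite hornerD hornerC mulrDr mulrDl (mulrC (a N u l) c) -(mulrA c).
    over.
  rewrite big_split /= -mulr_sumr.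
  over.
by apply: cvgD => //; exact: cvgMr.
Qed.

Let gram N u v (f g : C -> C) := \sum_(l < N) \sum_(l' < N)
  a N u l * (a N v l')^* * (f (t l) * (g (t l'))^* / (1 - t l * (t l')^*)).

(** With a constant in one slot, the sum over that slot collapses by [interpolation_exact]. *)
Lemma gram_cstr N u v f d : `|v| < 1 ->
  gram N u v f (fun=> d) =
  d^* * \sum_(l < N) a N u l * f (t l) / (1 - t l * v^*).
Proof.
move=> v1; rewrite /gram mulr_sumr; apply: eq_bigr => l _.
rewrite -(interpolation_exact v1 (ltn_ord l)) !mulr_sumr.
by apply: eq_bigr => l' _; ring.
Qed.

Lemma gram_cstl N u v c g : `|u| < 1 ->
  gram N u v (fun=> c) g =
  c * (\sum_(l < N) a N v l * g (t l) / (1 - t l * u^*))^*.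
Proof.
move=> u1; rewrite /gram exchange_big /= rmorph_sum mulr_sumr.
apply: eq_bigr => l' _.
rewrite !rmorphM /= -(interpolation_exact u1 (ltn_ord l')) rmorph_sum !mulr_sumr.
apply: eq_bigr => l _.
by rewrite rmorphM fmorphV rmorphB rmorphM rmorph1 /= !conjCK (mulrC (t l')^*); ring.
Qed.

(* Multiplication by ['X] acts on Szego kernels as the adjoint of the shift. *)
Lemma gram_shift N u v f g :
  gram N u v (fun x => f x * x) (fun x => g x * x) = gram N u v f g -
  (\sum_(l < N) a N u l * f (t l)) * (\sum_(l < N) a N v l * g (t l))^*.
Proof.
rewrite /gram mulr_suml -sumrB; apply: eq_bigr => l _.
rewrite rmorph_sum mulr_sumr -sumrB; apply: eq_bigr => l' _.
rewrite !rmorphM /=; field.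
by rewrite szego_neq0.
Qed.

Lemma cvg_szego_gram u v p r : `|u| < 1 -> `|v| < 1 ->
  \sum_(l < N) \sum_(l' < N) a N u l * (a N v l')^* *
    (p.[t l] * (r.[t l'])^* / (1 - t l * (t l')^*)) @[N --> \oo] -->
  p.[u] * (r.[v])^* / (1 - u * v^*).
Proof.
move=> u1 v1.
have cvg_conj (f : nat -> C) l : f n @[n --> \oo] --> l ->
    (f n)^* @[n --> \oo] --> l^*.
  move=> /cvgrPdist_le fl; apply/cvgrPdist_le => e /fl.
  by apply: filterS => n; rewrite -rmorphB norm_conjC.
suff : gram N u v (horner p) (horner r) @[N --> \oo] -->
  p.[u] * (r.[v])^* / (1 - u * v^*) by [].
have cvg_cstr q d : gram N u v (horner q) (fun=> d) @[N --> \oo] -->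
    q.[u] * d^* / (1 - u * v^*).
  under eq_fun do rewrite gram_cstr //.
  rewrite mulrAC mulrC; apply: cvgMr; exact: cvg_szego_combination.
have cvg_cstl q c : gram N u v (fun=> c) (horner q) @[N --> \oo] -->
    c * (q.[v])^* / (1 - u * v^*).
  under eq_fun do rewrite gram_cstl //.
  rewrite -mulrA; apply: cvgMr.
  rewrite (_ : _ / _ = (q.[v] / (1 - v * u^*))^*).
    by apply: cvg_conj; exact: cvg_szego_combination.
  by rewrite rmorphM fmorphV rmorphB rmorphM rmorph1 /= conjCK (mulrC u).
have horner0_cst : horner 0 = fun=> (0 : C) by apply/funext => x; exact: horner0.
elim/poly_ind: p r => [|p c IHp] r.
  by have := cvg_cstl r 0; rewrite horner0 horner0_cst.
(* Only a case split on [r]: [IHp] already holds for every second polynomial. *)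
elim/poly_ind: r => [|r d _].
  by have := cvg_cstr (p * 'X + c%:P) 0; rewrite horner0 horner0_cst.
have uv := szego_neq0 u1 v1.
set r' := r * 'X + d%:P.
(* Split off the constant terms [c] and [d]. The part divisible by ['X] in both variables is lowered
   by the shift, at the cost of a product of moments. *)
have -> : (p * 'X + c%:P).[u] * r'.[v]^* / (1 - u * v^*) =
    p.[u] * r.[v]^* / (1 - u * v^*) - p.[u] * r.[v]^* +
    (p * 'X).[u] * d^* / (1 - u * v^*) + c * r'.[v]^* / (1 - u * v^*).
  rewrite /r' !hornerMXaddC hornerMX rmorphD rmorphM /=; field.
  exact: uv.
under eq_fun => N.
  rewrite (_ : gram _ _ _ _ _ = gram N u v (horner p) (horner r) -
    (\sum_(l < N) a N u l * p.[t l]) * (\sum_(l < N) a N v l * r.[t l])^* +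
    gram N u v (horner (p * 'X)) (fun=> d) + gram N u v (fun=> c) (horner r')).
    over.
  rewrite -gram_shift /gram -!big_split; apply: eq_bigr => l _ /=.
  rewrite -!big_split; apply: eq_bigr => l' _ /=.
  by rewrite /r' !hornerMXaddC hornerMX rmorphD rmorphM /=; ring.
apply: cvgD => //; apply: cvgD => //; apply: cvgB; first exact: IHp.
apply: cvgM; first exact: cvg_moment.
by apply: cvg_conj; exact: cvg_moment.
Qed.

End Interpolation.

(** * Negative definiteness under entrywise limits *)

Section NegdefLimit.
Variable C : numClosedFieldType.

Lemma hermsymmx_congr M m (X : 'M[C]_M) (B : 'M[C]_(m, M)) :
  X \is hermsymmx -> B *m X *m B ^t* \is hermsymmx.
Proof.
rewrite !hermsymmxE => /eqP Xh.
by rewrite !adjmxM adjmxK -Xh mulmxA.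
Qed.

Lemma negdef_cvg M m (X : nat -> 'M[C]_M) (A : 'M[C]_M) (B : 'M[C]_(m, M)) :
  (forall N, X N \is hermsymmx) ->
  (forall i j, X N i j @[N --> \oo] --> A i j) ->
  B *m A *m B ^t* = - 1%:M -> exists N, negdef (B *m X N *m B ^t*).
Proof.
move=> Xh XA BAB.
have XB k l : (B *m X N *m B ^t*) k l @[N --> \oo] --> (- (k == l)%:R : C).
  have -> : - (k == l)%:R = (B *m A *m B ^t*) k l by rewrite BAB !mxE.
  rewrite mxE; under eq_fun do rewrite mxE.
  apply: cvg_big => [|j _]; first exact: add_continuous.
  apply: cvgMl; rewrite mxE; under eq_fun do rewrite mxE.
  apply: cvg_big => [|i _]; first exact: add_continuous.
  exact: cvgMr.
have e_gt0 : 0 < (2 * m.+1%:R)^-1 :> C by rewrite invr_gt0 mulr_gt0 ?ltr0n.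
have near_kl k l : \forall N \near \oo,
    `|(B *m X N *m B ^t*) k l + (k == l)%:R| <= (2 * m.+1%:R)^-1.
  have /cvgrPdist_le/(_ _ e_gt0) := XB k l; apply: filterS => N.
  by rewrite distrC opprK.
have [N _ /(_ N (leqnn N)) NB] : \forall N \near \oo, forall k l,
    `|(B *m X N *m B ^t*) k l + (k == l)%:R| <= (2 * m.+1%:R)^-1.
  by apply: filter_forall => k; apply: filter_forall.
by exists N; apply: negdef_near => //; exact: hermsymmx_congr.
Qed.

Variable t : nat -> C.
Hypothesis cvg_expr : forall x : C, `|x| < 1 -> x ^+ n @[n --> \oo] --> (0 : C).
Hypothesis t_inj : injective t.
Hypothesis t_le : forall l, `|t l| <= 2^-1.

(** The shape of a Schur kernel entry after clearing denominators: [p], [p'] stand for the identity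
    term and [s], [s'] for the term with [S]. *)
Definition szego_form n (p s : 'I_n -> {poly C}) (p' s' : 'I_n -> {poly C}) z w :=
  \sum_c ((p c).[z] * ((p' c).[w])^* / (1 - z * w^*) -
          (s c).[z] * ((s' c).[w])^* / (1 - z * w^*)).

Lemma szego_form_conj n (p s p' s' : 'I_n -> {poly C}) z w :
  (szego_form p' s' p s w z)^* = szego_form p s p' s' z w.
Proof.
rewrite rmorph_sum; apply: eq_bigr => c _.
rewrite rmorphB !rmorphM !fmorphV rmorphB rmorphM rmorph1 /= !conjCK.
by rewrite (mulrC w^*) ![(_.[w])^* * _]mulrC.
Qed.

Lemma negdef_szego n M m (u : 'I_M -> C) (p s : 'I_M -> 'I_n -> {poly C})
    (B : 'M[C]_(m, M)) : (forall i, `|u i| < 1) ->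
  B *m (\matrix_(i, j) szego_form (p i) (s i) (p j) (s j) (u i) (u j)) *m B ^t* =
    - 1%:M ->
  exists N (b : 'I_M -> 'I_N -> C), negdef (B *m (\matrix_(i, j)
    \sum_l \sum_l' b i l * (b j l')^* *
      szego_form (p i) (s i) (p j) (s j) (t l) (t l')) *m B ^t*).
Proof.
move=> u1.
have t_lt1 l : `|t l| < 1.
  by apply: le_lt_trans (t_le l) _; rewrite invf_lt1 ?ltr0n // ltr1n.
have [a aE] := choice (szego_interpolation t_lt1 t_inj).
pose X N : 'M[C]_M := \matrix_(i, j) \sum_(l < N) \sum_(l' < N)
  a N (u i) l * (a N (u j) l')^* * szego_form (p i) (s i) (p j) (s j) (t l) (t l').
move=> /(@negdef_cvg _ _ X)[||N NX]; last by exists N, (fun i l => a N (u i) l).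
  move=> N; rewrite hermsymmxE; apply/eqP/matrixP => i j.
  rewrite !mxE exchange_big rmorph_sum; apply: eq_bigr => l _.
  rewrite rmorph_sum; apply: eq_bigr => l' _.
  by rewrite !rmorphM /= conjCK szego_form_conj (mulrC (a _ _ _)).
move=> i j; rewrite mxE; under eq_fun => N.
  rewrite mxE /szego_form.
  under eq_bigr => l _ do under eq_bigr => l' _ do rewrite mulr_sumr.
  under eq_bigr => l _ do rewrite exchange_big /=.
  rewrite exchange_big /=.
  under eq_bigr => c _.
    under eq_bigr => l _.
      under eq_bigr => l' _ do rewrite mulrBr.
      rewrite sumrB.
      over.
    rewrite sumrB.
    over.
  over.
apply: cvg_big => [|c _]; first exact: add_continuous.
by apply: cvgB; apply: cvg_szego_gram.
Qed.

End NegdefLimit.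

(** * A common denominator for a rational matrix *)

Section RationalMatrix.
Variables (F : fieldType) (n : nat) (S : 'M[{fraction {poly F}}]_n).

Definition ratmx_den : {poly F} := \prod_i \prod_j ratf_den (S i j).

Definition ratmx_num i j : {poly F} :=
  ratf_num (S i j) * (ratmx_den %/ ratf_den (S i j)).

Lemma ratmx_den_neq0 z : ~ ratmx_poles S z -> ratmx_den.[z] != 0.
Proof.
move=> zP; rewrite horner_prod; apply/prodf_neq0 => i _.
rewrite horner_prod; apply/prodf_neq0 => j _.
by apply/negP => ij; apply: zP; exists i, j.
Qed.

Lemma ratmx_evalE z i j : ratmx_den.[z] != 0 ->
  ratmx_den.[z] * ratmx_eval S z i j = (ratmx_num i j).[z].
Proof.
have den_dvd : ratf_den (S i j) %| ratmx_den.
  by rewrite /ratmx_den (bigD1 i) //= (bigD1 j) //= -mulrA dvdp_mulr.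
rewrite mxE /ratf_eval /ratmx_num -{1 2}(divpK den_dvd) !hornerM mulf_eq0.
by case/norP => _ d0; field.
Qed.

End RationalMatrix.

(** * Schur kernels as Szego forms *)

Section SchurKernel.
Variables (R : realType) (n : nat) (S : 'M[{fraction {poly R[i]}}]_n).
Local Notation C := R[i].
Local Notation q := (ratmx_den S).
Implicit Types eta xi : 'cV[C]_n.

Lemma schur_kernel_conj z w : schur_kernel S z w = (schur_kernel S w z) ^t*.
Proof.
rewrite /schur_kernel adjmxZ fmorphV rmorphB (rmorph1 Num.conj) rmorphM /= conjCK.
by rewrite (mulrC w^*) adjmxB adjmx1 adjmxM adjmxK.
Qed.

Lemma kernel_mx_schur_hermsymmx M (u : 'I_M -> C) (xi : 'I_M -> 'cV[C]_n) :
  kernel_mx (schur_kernel S) u xi \is hermsymmx.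
Proof.
rewrite hermsymmxE; apply/eqP/matrixP => k j.
have E k' j' : kernel_mx (schur_kernel S) u xi k' j' =
    ((xi k') ^t* *m schur_kernel S (u k') (u j') *m xi j') 0 0 by rewrite mxE.
rewrite [RHS]mxE [(_^T)%R _ _]mxE !E.
rewrite schur_kernel_conj; set K := schur_kernel _ _ _.
rewrite (_ : _ *m _ = ((xi j) ^t* *m K *m xi k) ^t*).
  by rewrite [LHS]mxE [(_^T)%R _ _]mxE.
by rewrite !adjmxM adjmxK mulmxA.
Qed.

(** Entries of the row [q eta^*]; those of [num_comb] are the entries of [q eta^* S]. *)
Definition den_comb eta (c : 'I_n) : {poly C} := (eta c 0)^* *: q.

Definition num_comb eta (c : 'I_n) : {poly C} :=
  \sum_b (eta b 0)^* *: ratmx_num S b c.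

(** Scaling the vectors by conjugates of [q] puts [q(z)] next to [S(z)] and [q(w)^*] next to
    [S(w)^*], which clears both denominators. *)
Lemma schur_kernel_szego_form eta eta' z w : q.[z] != 0 -> q.[w] != 0 ->
  (((q.[z])^* *: eta) ^t* *m schur_kernel S z w *m ((q.[w])^* *: eta')) 0 0 =
  szego_form (den_comb eta) (num_comb eta) (den_comb eta') (num_comb eta') z w.
Proof.
have conjE x e : ((q.[x])^* *: e) ^t* = q.[x] *: e ^t*.
  by rewrite adjmxZ conjCK.
have denE x e : q.[x] *: e ^t* = \row_c (den_comb e c).[x].
  by apply/rowP => c; rewrite !mxE hornerZ mulrC.
have numE x e : q.[x] != 0 ->
    q.[x] *: e ^t* *m ratmx_eval S x = \row_c (num_comb e c).[x].
  move=> qx; apply/rowP => c; rewrite !mxE horner_sum; apply: eq_bigr => b _.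
  by rewrite !mxE hornerZ -ratmx_evalE // !mxE; ring.
move=> qz qw; rewrite -[_ *: eta'](adjmxK (C := C)) !conjE.
rewrite /schur_kernel -scalemxAr -scalemxAl mulmxBr mulmxBl mulmx1.
rewrite mulmxA -(mulmxA _ (ratmx_eval S w ^t*)).
rewrite -adjmxM !numE // !denE !mxE -sumrB mulr_sumr; apply: eq_bigr => c _.
by rewrite !mxE; ring.
Qed.

End SchurKernel.

(** * Transfer from the real interval to the disk *)

Section Complex.
Variable R : realType.
Local Notation C := R[i].

Lemma cvg_exprC (x : (C : numClosedFieldType)) :
  `|x| < 1 -> x ^+ n @[n --> \oo] --> (0 : (C : numClosedFieldType)).
Proof.
rewrite normc_def; set r := Num.sqrt _ => r1.
have /cvgr0Pnorm_le r0 : r ^+ n @[n --> \oo] --> (0 : R).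
  by apply: cvg_expr; rewrite ger0_norm ?sqrtr_ge0 // -ltcR.
apply/cvgr0Pnorm_le => e e0.
have eE : e = (complex.Re e)%:C%C by rewrite RRe_real // gtr0_real.
have /r0 : 0 < complex.Re e by rewrite -ltcR -eE.
apply: filterS => n; rewrite ger0_norm ?exprn_ge0 ?sqrtr_ge0 // => rn.
by rewrite normrX normc_def -/r -(rmorphXn (real_complex R)) eE lecR.
Qed.

Lemma interpolation_nodes (P : set C) : finite_set P ->
  exists t : nat -> C, [/\ injective t, forall l, `|t l| <= 2^-1 &
    forall l, (real_unit_interval R `\` P) (t l)].
Proof.
move=> /finite_seqP[s ->].
have [d d0 ds] : exists2 d : R, 0 < d & forall x, 0 < x < d -> x%:C%C \notin s.
  elim: s => [|y s [d d0 ds]]; first by exists 1.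
  exists (Num.min d (if 0 < complex.Re y then complex.Re y else 1)).
    by rewrite lt_min d0; case: ifP => // _; exact: ltr01.
  move=> x /andP[x0]; rewrite lt_min => /andP[xd xy].
  rewrite inE negb_or ds ?x0 // andbT; apply: contraTneq xy => <- /=.
  by rewrite x0 ltxx.
(* Dividing by at least 2 keeps the nodes strictly below [d] and at most 1/2. *)
pose r l : R := Num.min d 1 / l.+2%:R.
have m0 : 0 < Num.min d 1 by rewrite lt_min d0 ltr01.
have r0 l : 0 < r l by rewrite divr_gt0 ?ltr0n.
have rm l : r l < Num.min d 1 by rewrite ltr_pdivrMr ?ltr0n // ltr_pMr // ltr1n.
exists (fun l => (r l)%:C%C); split.
- move=> k l /complexI; rewrite /r => /(mulfI (lt0r_neq0 m0)) /invr_inj /eqP.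
  by rewrite eqr_nat => /eqP [].
- move=> l; rewrite normc_def /= expr0n addr0 sqrtr_sqr gtr0_norm //.
  rewrite -[2]/(2%:R) -(rmorph_nat (real_complex R)) -fmorphV lecR /r.
  apply: (@le_trans _ _ (l.+2%:R)^-1).
    by rewrite ler_piMl ?invr_ge0 ?ler0n // ge_min lexx orbT.
  by rewrite lef_pV2 ?posrE ?ltr0n // ler_nat.
- move=> l; have rd : r l < d by have := rm l; rewrite lt_min => /andP[].
  split; last by apply/negP; rewrite ds // r0.
  exists (r l) => //=; rewrite in_itv /= (lt_trans _ (r0 l)) ?oppr_lt0 ?ltr01 //.
  by have := rm l; rewrite lt_min => /andP[].
Qed.

(** The bound reaches every point of the disk that is not a pole, whatever finite [P] was removed
    from the interval. *)
Lemma neg_eigenvalues_disk n (S : 'M[{fraction {poly C}}]_n) (P : set C) kappa :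
  finite_set P -> ratmx_poles S `&` real_unit_interval R `<=` P ->
  (forall M (u : 'I_M -> C) (xi : 'I_M -> 'cV[C]_n),
    (forall k, (real_unit_interval R `\` P) (u k)) ->
    (neg_eigenvalues (kernel_mx (schur_kernel S) u xi) <= kappa)%N) ->
  forall M (u : 'I_M -> C) (xi : 'I_M -> 'cV[C]_n),
    (forall k, (unit_disk R `\` ratmx_poles S) (u k)) ->
    (neg_eigenvalues (kernel_mx (schur_kernel S) u xi) <= kappa)%N.
Proof.
move=> finP polesP le_kappa M u xi uP.
set q := ratmx_den S.
have [t [t_inj t_le tP]] := interpolation_nodes finP.
have qt l : q.[t l] != 0.
  have [tI tnP] := tP l; apply: ratmx_den_neq0 => tS.
  by apply: tnP; apply: polesP.
have qu k : q.[u k] != 0 by apply: ratmx_den_neq0; have [] := uP k.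
(* Undoes in advance the scaling required by [schur_kernel_szego_form]. *)
pose eta k := ((q.[u k])^*)^-1 *: xi k.
have xiE k : xi k = (q.[u k])^* *: eta k.
  by rewrite scalerA divff ?scale1r // conjC_eq0.
have [B] := neg_eigenvalues_witness (kernel_mx_schur_hermsymmx S u xi) (leqnn _).
set A := kernel_mx _ _ _; set m := neg_eigenvalues A in B *.
rewrite (_ : A = \matrix_(i, j)
  szego_form (den_comb S (eta i)) (num_comb S (eta i))
    (den_comb S (eta j)) (num_comb S (eta j)) (u i) (u j)); last first.
  apply/matrixP => i j.
  by rewrite [RHS]mxE -schur_kernel_szego_form // -!xiE [LHS]mxE.
move=> /(negdef_szego cvg_exprC t_inj t_le)[|N [b]].
  by move=> k; have [] := uP k.
(* Each node is repeated for every row [i], since the vector [eta i] attached to it depends on [i].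
   Row [i] of [Z] holds the weights [b i l] in the columns [(i, l)]. *)
set I := ('I_M * 'I_N)%type.
pose t' (k : 'I_#|{: I}|) : C := t (enum_val k).2.
pose xi' (k : 'I_#|{: I}|) := (q.[t (enum_val k).2])^* *: eta (enum_val k).1.
pose Z : 'M[C]_(M, #|{: I}|) :=
  \matrix_(i, k) (b i (enum_val k).2 *+ (i == (enum_val k).1)).
have sumE i (c : 'I_N -> C) (g : I -> C) :
    \sum_(k < #|{: I}|) (c (enum_val k).2 *+ (i == (enum_val k).1)) * g (enum_val k) =
    \sum_l c l * g (i, l).
  rewrite -(big_enum_val (A := {: I}) (fun x => (c x.2 *+ (i == x.1)) * g x)) /=.
  transitivity (\sum_k \sum_l (c l *+ (i == k)) * g (k, l)).
    by rewrite pair_bigA; apply: eq_big => [x|[k l] _].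
  rewrite (bigD1 i) //= [X in _ + X]big1 ?addr0 => [|k ki].
    by apply: eq_bigr => l _; rewrite eqxx.
  by rewrite big1 // => l _; rewrite eq_sym (negbTE ki) mul0r.
set X := (X in B *m X *m _).
have -> : X = Z *m kernel_mx (schur_kernel S) t' xi' *m Z ^t*.
  pose h (x y : I) : C := szego_form (den_comb S (eta x.1)) (num_comb S (eta x.1))
    (den_comb S (eta y.1)) (num_comb S (eta y.1)) (t x.2) (t y.2).
  apply/matrixP => i j; rewrite [RHS]mxE [LHS]mxE.
  transitivity (\sum_(k' < #|{: I}|)
      ((b j (enum_val k').2)^* *+ (j == (enum_val k').1)) *
      (\sum_l b i l * h (i, l) (enum_val k'))); last first.
    apply: eq_bigr => k' _; rewrite mulrC; congr (_ * _).
      rewrite [RHS]mxE -(sumE i (b i) (fun x => h x (enum_val k'))).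
      apply: eq_bigr => k _; rewrite mxE [kernel_mx _ _ _ _ _]mxE.
      by rewrite /xi' /t' schur_kernel_szego_form.
    by rewrite !mxE rmorphMn.
  rewrite (sumE j (fun l => (b j l)^*) (fun y => \sum_l b i l * h (i, l) y)).
  under [RHS]eq_bigr do rewrite mulr_sumr.
  rewrite exchange_big /=; apply: eq_bigr => l' _.
  apply: eq_bigr => l _; rewrite /h /=; ring.
rewrite !mulmxA -(mulmxA (B *m Z *m _)) -adjmxM.
move=> /negdef_le_neg_eigenvalues le_m.
apply: leq_trans (le_m _) (le_kappa _ _ _ _) => [|k]; last exact: tP.
exact: kernel_mx_schur_hermsymmx.
Qed.

End Complex.

Theorem theorem5p3 (R : realType) (n : nat) (S : 'M[{fraction {poly R[i]}}]_n)
    (P P1 : set R[i])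
    (finP : finite_set P)
    (subP : P `<=` real_unit_interval R)
    (polesP : ratmx_poles S `&` real_unit_interval R `<=` P)
    (finP1 : finite_set P1)
    (subP1 : P1 `<=` unit_disk R)
    (polesP1 : ratmx_poles S `&` unit_disk R `<=` P1)
    (kappa : nat) :
  negative_squares (schur_kernel S) (real_unit_interval R `\` P) kappa ->
  negative_squares (schur_kernel S) (unit_disk R `\` P1) kappa.
Proof.
move=> [_ le_kappa [M0 [u0 [xi0 [u0P eq_kappa]]]]].
have int_disk : real_unit_interval R `<=` unit_disk R.
  move=> _ [x /= + <-]; rewrite in_itv /= /unit_disk /= => x1.
  rewrite normc_def /= expr0n addr0 sqrtr_sqr -(rmorph1 (real_complex R)) ltcR.
  by rewrite ltr_norml.
have disk_poles z : (unit_disk R `\` P1) z -> (unit_disk R `\` ratmx_poles S) z.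
  by move=> [zD zP1]; split=> // zS; apply/zP1/polesP1.
have le_disk M (u : 'I_M -> R[i]) (xi : 'I_M -> 'cV_n) :
    (forall k, (unit_disk R `\` P1) (u k)) ->
    (neg_eigenvalues (kernel_mx (schur_kernel S) u xi) <= kappa)%N.
  move=> uP; apply: (neg_eigenvalues_disk finP polesP le_kappa) => k.
  exact: disk_poles.
split=> // [z w _ _|]; first exact: schur_kernel_conj.
apply: contrapT => not_attained.
have lt_kappa M (u : 'I_M -> R[i]) (xi : 'I_M -> 'cV_n) :
    (forall k, (unit_disk R `\` P1) (u k)) ->
    (neg_eigenvalues (kernel_mx (schur_kernel S) u xi) < kappa)%N.
  move=> uP; rewrite ltn_neqAle le_disk // andbT; apply/eqP => ukappa.
  by apply: not_attained; exists M, u, xi.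
(* The empty kernel matrix already has fewer than [kappa] negative eigenvalues, so [kappa.-1] is a
   true predecessor. *)
have kappa_gt0 : (0 < kappa)%N.
  apply: leq_ltn_trans (lt_kappa 0 (fun=> 0) (fun=> 0) _) => //.
  by case.
have finPP1 : finite_set (P `|` P1) by rewrite finite_setU.
have polesPP1 : ratmx_poles S `&` real_unit_interval R `<=` P `|` P1.
  by move=> z /polesP; left.
(* Some [u0 k] may lie in [P1], where [lt_kappa] says nothing. The bound is therefore taken on the
   interval without [P] and [P1] and carried back to all points of the disk that are not poles. *)
have : (neg_eigenvalues (kernel_mx (schur_kernel S) u0 xi0) <= kappa.-1)%N.
  apply: (neg_eigenvalues_disk finPP1 polesPP1) => [M u xi uP|k].
    rewrite -ltnS prednK //; apply: lt_kappa => k.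
    by have [/int_disk uD nP] := uP k; split=> // uP1; apply: nP; right.
  have [uI nP] := u0P k; split; first exact: int_disk.
  by move=> uS; apply: nP; apply: polesP.
by rewrite eq_kappa -ltnS prednK // ltnn.
Qed.
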